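(* For every $2$-degenerate graph $G$ on $n$ vertices, $\mathrm{ssp}(G) \leq n$.
   Context: All graphs are finite and simple. A graph $G$ is $2$-degenerate if every subgraph of $G$ contains a vertex of degree at most $2$. Given a collection $\mathcal{P}$ of paths in a graph $G$, two edges $e,f$ of $G$ are separated by $\mathcal{P}$ if there are paths $P_e,P_f\in\mathcal{P}$ such that $P_e$ contains $e$ but not $f$, and $P_f$ contains $f$ but not $e$. $\mathcal{P}$ is a strongly separating path system of $G$ if it separates every pair of distinct edges of $G$. $\mathrm{ssp}(G)$ denotes the minimum size of a strongly separating path system of $G$. *)

(* Defs.v *)
From mathcomp Require Import all_boot.

Set Implicit Arguments.
Unset Strict Implicit.
Unset Printing Implicit Defensive.

Record sgraph := SGraph {
  vertex :> finType;
  adj : rel vertex;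
  adj_sym : symmetric adj;
  adj_irr : irreflexive adj }.

Definition edges (G : sgraph) : {set {set G}} :=
  [set [set x; y] | x in G, y in G & adj x y].

(* The subgraph with vertex set S and adjacency f; it need not be induced. *)
Definition subgraph (G : sgraph) (S : {set G}) (f : rel G) : Prop :=
  symmetric f /\ forall x y, f x y -> [/\ x \in S, y \in S & adj x y].

(* The graph without vertices is not counted among the subgraphs. *)
Definition degenerate (d : nat) (G : sgraph) : Prop :=
  forall (S : {set G}) (f : rel G), subgraph S f -> S != set0 ->
    exists2 x, x \in S & #|[set y | f x y]| <= d.

Definition is_path (G : sgraph) (p : seq G) : bool :=
  [&& p != [::], uniq p & sorted (@adj G) p].

Definition path_edges (G : sgraph) (p : seq G) : seq {set G} :=
  [seq [set xy.1; xy.2] | xy <- zip p (behead p)].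

(* A path has distinct vertices, so bounding its length by #|G| loses nothing
   and makes collections of paths finite sets.  A path and its reversal are
   distinct here, but have the same edges, so this does not affect the minimum
   size of a separating system. *)
Definition path_system (G : sgraph) (P : {set #|G|.-bseq G}) : bool :=
  [forall p in P, is_path p].

Definition separated (G : sgraph) (P : {set #|G|.-bseq G}) (e f : {set G}) :
    bool :=
  [exists p in P, (e \in path_edges p) && (f \notin path_edges p)] &&
  [exists q in P, (f \in path_edges q) && (e \notin path_edges q)].

Definition strongly_separating (G : sgraph) (P : {set #|G|.-bseq G}) : bool :=
  path_system P &&
  [forall e in edges G, forall f in edges G, (e != f) ==> separated P e f].

Definition has_ssp (G : sgraph) (k : nat) : bool :=
  [exists P : {set #|G|.-bseq G}, strongly_separating P && (#|P| == k)].

Lemma edge_path (G : sgraph) (e f : {set G})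
    (P := [set p : #|G|.-bseq G | is_path p]) :
  e \in edges G -> e != f ->
  [exists p in P, (e \in path_edges p) && (f \notin path_edges p)].
Proof.
case/imset2P=> x y _; rewrite inE => /andP[_ xy] -> ne.
have nxy : x != y by apply: contraTneq xy => ->; rewrite adj_irr.
have sz : size [:: x; y] <= #|G|.
  have /card_uniqP <- : uniq [:: x; y] by rewrite /= inE nxy.
  exact: max_card.
apply/existsP; exists (Bseq sz); rewrite !inE /= /is_path /= inE nxy xy /=.
by rewrite [f == _]eq_sym ne eqxx.
Qed.

Lemma has_sspP (G : sgraph) : exists k, has_ssp G k.
Proof.
exists #|[set p : #|G|.-bseq G | is_path p]|.
apply/existsP; exists [set p : #|G|.-bseq G | is_path p].
rewrite eqxx andbT; apply/andP; split.
  by apply/forall_inP => p; rewrite inE.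
apply/forall_inP => e eE; apply/forall_inP => f fE; apply/implyP => ne.
by rewrite /separated !edge_path // eq_sym.
Qed.

Definition ssp (G : sgraph) : nat := ex_minn (has_sspP G).

(* Main.v *)
(** Build the graph by adding vertices of degree at most two, and keep one path
    per vertex so that the paths strongly separate the edges, every edge lies on
    at least two paths, and every vertex is at least twice an end of a path (the
    path reduced to one vertex counts twice).  To add [v], choose for each
    neighbour [x] of [v] a path ending at [x], with distinct paths for distinct
    neighbours, and extend it by the edge [xv]; the path of [v] itself consists
    of all the new edges.  A neighbour loses one end and gets it back from the
    path of [v]. *)

Require Import Defs.
From mathcomp Require Import all_boot.

Set Implicit Arguments.
Unset Strict Implicit.
Unset Printing Implicit Defensive.

(** * Ends of a path and extension at an end *)

Section PathEnds.

Variable G : sgraph.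
Implicit Types (p : seq G) (b : bool) (v x : G) (e : {set G}).

(** The Boolean selects an end of [p], and orienting brings that end to the head, so that both ends
    are handled by list heads. *)
Definition orient b p := if b then p else rev p.

Definition ends_at b p x := ohead (orient b p) == Some x.

Definition extend b v p := orient b (v :: orient b p).

Lemma path_edges_cons x y p :
  path_edges [:: x, y & p] = [set x; y] :: path_edges (y :: p).
Proof. by []. Qed.

Lemma path_edges_rcons p y x :
  path_edges (rcons (rcons p y) x) = rcons (path_edges (rcons p y)) [set y; x].
Proof.
elim: p => [|z [|t p] IHp] //.
exact: (congr1 (cons [set z; t]) IHp).
Qed.

Lemma path_edges_rev p : path_edges (rev p) =i path_edges p.
Proof.
elim: p => [|x [|y p] IHp] e //.
rewrite path_edges_cons inE -IHp !rev_cons path_edges_rcons mem_rcons inE.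
by rewrite setUC.
Qed.

Lemma path_edges_orient b p : path_edges (orient b p) =i path_edges p.
Proof. by case: b => // e; rewrite path_edges_rev. Qed.

Lemma path_edges_subset p e x : e \in path_edges p -> x \in e -> x \in p.
Proof.
elim: p => [|y [|z p] IHp] //; rewrite path_edges_cons !inE.
case/predU1P=> [->|ep xe]; first by rewrite !inE => /orP[] ->; rewrite ?orbT.
by have := IHp ep xe; rewrite inE => ->; rewrite orbT.
Qed.

Lemma mem_orient b p : orient b p =i p.
Proof. by case: b => // x; rewrite mem_rev. Qed.

Lemma orientK b : involutive (orient b).
Proof. by case: b => p //=; rewrite revK. Qed.

Lemma is_path_orient b p : is_path (orient b p) = is_path p.
Proof.
case: b => //=; rewrite /is_path rev_uniq rev_sorted.
rewrite -(size_eq0 (rev p)) size_rev size_eq0.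
by congr [&& _, _ & _]; apply: eq_sorted => x y; rewrite adj_sym.
Qed.

Lemma ends_at_cons b p x : ends_at b p x -> exists q, orient b p = x :: q.
Proof.
by rewrite /ends_at; case: (orient b p) => [|y q] //= /eqP[->]; exists q.
Qed.

Lemma mem_extend b v p : extend b v p =i v :: p.
Proof. by move=> x; rewrite mem_orient !inE mem_orient. Qed.

Lemma is_path_extend b v p x :
  ends_at b p x -> v \notin p -> adj x v -> is_path p -> is_path (extend b v p).
Proof.
move=> /ends_at_cons[q pq]; rewrite -(mem_orient b) is_path_orient pq => vq xv.
rewrite -(is_path_orient b) pq => /and3P[_ /= uq sq].
by rewrite /is_path /= vq uq adj_sym xv sq.
Qed.

Lemma path_edges_extend b v p x e :
  ends_at b p x ->
  (e \in path_edges (extend b v p)) = (e == [set x; v]) || (e \in path_edges p).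
Proof.
move=> /ends_at_cons[q pq]; rewrite path_edges_orient pq path_edges_cons inE.
by rewrite -pq path_edges_orient setUC.
Qed.

Lemma ends_at_extend b v p : ends_at b (extend b v p) v.
Proof. by rewrite /ends_at orientK. Qed.

Lemma ends_at_extendN b v p x :
  ends_at (~~ b) p x -> ends_at (~~ b) (extend b v p) x.
Proof.
move=> /ends_at_cons[q]; rewrite /ends_at /extend; case: b => /= pq.
  by rewrite rev_cons pq.
by rewrite pq rev_cons revK.
Qed.

End PathEnds.

(** * Good path systems on a vertex set *)

Section AddVertex.

Variable G : sgraph.
Implicit Types (S : {set G}) (p : G -> seq G) (e f : {set G}) (v x : G).

(* [a] is the path index together with [true] for its first vertex and [false]
   for its last one. *)
Definition end_of p (a : G * bool) x := ends_at a.2 (p a.1) x.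

Definition twice_end S p x :=
  exists a c, [/\ a.1 \in S, c.1 \in S, a != c, end_of p a x & end_of p c x].

(** Indexing the paths by [S] itself bounds their number by [#|S|]. [good_sep] is one-sided because
    [e] and [f] can be exchanged. [good_cover] expresses that [e] lies on at least two paths:
    whichever index [k] is excluded, one remains. *)
Record good_system S p : Prop := GoodSystem {
  good_path : forall i, i \in S -> is_path (p i);
  good_mem : forall i x, i \in S -> x \in p i -> x \in S;
  good_ends : forall x, x \in S -> twice_end S p x;
  good_sep : forall e f, e \in edges G -> f \in edges G ->
    e \subset S -> f \subset S -> e != f ->
    exists i, [/\ i \in S, e \in path_edges (p i) & f \notin path_edges (p i)];
  good_cover : forall e k, e \in edges G -> e \subset S ->
    exists i, [/\ i \in S, i != k & e \in path_edges (p i)] }.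

Definition nbrs S v := [set x in S | adj x v].

(** [R] is the path given to [v], and [a x] is the end at which a path is extended by the edge from
    [x] to [v]. When distinct neighbours choose distinct paths, [pick] has at most one candidate. *)
Definition add_vertex S v (R : seq G) (a : G -> G * bool) p i :=
  if i == v then R else
  if [pick x in nbrs S v | (a x).1 == i] is Some x
  then extend (a x).2 v (p i) else p i.

Lemma edge_setU1 S v e : e \in edges G -> e \subset v |: S ->
  e \subset S \/ exists2 x, x \in nbrs S v & e = [set x; v].
Proof.
case/imset2P=> x y _; rewrite inE => /andP[_ xy] ->.
rewrite !subUset !sub1set !inE => /andP[xS yS].
have [xv|nxv] := eqVneq x v.
  right; exists y; last by rewrite xv setUC.
  rewrite inE adj_sym -xv xy andbT; move: yS; rewrite -xv.
  by case/predU1P=> // yx; rewrite yx adj_irr in xy.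
have [yv|nyv] := eqVneq y v.
  by right; exists x; rewrite ?yv // inE -yv xy andbT; rewrite (negPf nxv) in xS.
by left; rewrite (negPf nxv) (negPf nyv) /= in xS yS; rewrite xS.
Qed.

Lemma set2_inj v : injective (fun x => [set x; v]).
Proof.
move=> x y /setP E; have := E x; have := E y; rewrite !inE !eqxx /=.
case/predU1P=> [->//|/eqP yv] /esym/predU1P[//|/eqP xv].
by rewrite xv yv.
Qed.

(** * Adding one vertex, given its path and the chosen ends *)

Section Step.

Variables (S : {set G}) (v : G) (p : G -> seq G).
Variables (R : seq G) (a : G -> G * bool).
Let N := nbrs S v.
Let p' := add_vertex S v R a p.

Hypotheses (vS : v \notin S) (good_p : good_system S p).
Hypotheses (aS : forall x, x \in N -> (a x).1 \in S)
  (a_end : forall x, x \in N -> end_of p (a x) x)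
  (a_inj : {in N &, injective (fun x => (a x).1)}).
Hypotheses (R_path : is_path R) (R_mem : forall x, x \in R -> x \in v |: N)
  (R_edges : forall e,
     reflect (exists2 x, x \in N & e = [set x; v]) (e \in path_edges R))
  (R_end : forall x, x \in N -> exists b, ends_at b R x).

Let neq_v i : i \in S -> (i == v) = false.
Proof. by move=> iS; apply: contraNF vS => /eqP <-. Qed.

Lemma add_vertexR : p' v = R.
Proof. by rewrite /p' /add_vertex eqxx. Qed.

Lemma add_vertex_nbr x : x \in N -> p' (a x).1 = extend (a x).2 v (p (a x).1).
Proof.
move=> xN; rewrite /p' /add_vertex neq_v ?aS //.
case: pickP => [y /andP[yN /eqP ay]|/(_ x)]; last by rewrite -/N xN eqxx.
by rewrite (a_inj yN xN ay).
Qed.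

Variant add_vertex_spec i : seq G -> Prop :=
| AddVertexNbr x of x \in N & (a x).1 = i :
    add_vertex_spec i (extend (a x).2 v (p i))
| AddVertexOther of (forall x, x \in N -> (a x).1 != i) :
    add_vertex_spec i (p i).

Lemma add_vertexP i : i \in S -> add_vertex_spec i (p' i).
Proof.
move=> iS; rewrite /p' /add_vertex neq_v //.
case: pickP => [x /andP[xN /eqP ax]|E]; first exact: AddVertexNbr.
by apply: AddVertexOther => x xN; have := E x; rewrite -/N xN /= => ->.
Qed.

Lemma new_edge_notin x i : i \in S -> [set x; v] \notin path_edges (p i).
Proof.
move=> iS; apply: contra vS => /path_edges_subset/(_ (set22 x v)).
exact: (good_mem good_p).
Qed.

Lemma new_edge_notsub x : ([set x; v] \subset S) = false.
Proof. by rewrite subUset !sub1set (negPf vS) andbF. Qed.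

(** An extension contributes a single edge, and that edge contains [v], which is outside [S]. *)
Lemma old_edge e i : i \in S -> e \subset S ->
  (e \in path_edges (p' i)) = (e \in path_edges (p i)).
Proof.
move=> iS eS; case: add_vertexP => // x xN ax.
have endx : ends_at (a x).2 (p i) x by rewrite -ax; apply: a_end.
rewrite (path_edges_extend _ _ endx) orbC.
by case: eqP eS => [->|]; rewrite ?new_edge_notsub ?orbF.
Qed.

(** The old paths avoid [v], so the edge can only come from an extension, and by [a_inj] only from
    the one made for [x]. *)
Lemma new_edge x i : i \in S -> x \in N ->
  ([set x; v] \in path_edges (p' i)) = (i == (a x).1).
Proof.
move=> iS xN; case: add_vertexP => // [y yN ay|ne].
  have endy : ends_at (a y).2 (p i) y by rewrite -ay; apply: a_end.
  rewrite (path_edges_extend _ _ endy) (negPf (new_edge_notin x iS)) orbF -ay.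
  rewrite (inj_eq (set2_inj (v := v))).
  by apply/eqP/eqP => [->|/(a_inj yN xN)].
by rewrite (negPf (new_edge_notin x iS)) eq_sym (negPf (ne x xN)).
Qed.

(** Extending for a neighbour [y] displaces only the end [a y], whose vertex is [y]. If that end is
    [c], then [x] is [y] and [c] is [a x], which is excluded. *)
Lemma old_end x c : c.1 \in S -> end_of p c x -> (x \in N -> c != a x) ->
  end_of p' c x.
Proof.
case: c => i b /= iS cx ne; rewrite /end_of /=.
case: add_vertexP => // y yN ay.
have [/= eb|nb] := eqVneq b (a y).2.
  have ayi : a y = (i, b) by rewrite eb -ay; case: (a y).
  have := a_end yN; move: cx; rewrite ayi /end_of /ends_at /=.
  move=> /eqP-> /eqP[xy]; have := ne; rewrite xy => /(_ yN).
  by rewrite ayi eqxx.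
have eb : b = ~~ (a y).2 by case: b nb {cx ne}; case: (a y).2.
by rewrite eb; apply: ends_at_extendN; rewrite -eb.
Qed.

Lemma add_vertex_end x : x \in N -> end_of p' (a x) v.
Proof. by move=> xN; rewrite /end_of add_vertex_nbr // ends_at_extend. Qed.

(** How [v] gets its two ends depends on its degree, so this condition is left to the caller; the
    others are treated uniformly. *)
Lemma add_vertex_good :
  twice_end (v |: S) p' v -> good_system (v |: S) p'.
Proof.
move=> v_ends; have NS x : x \in N -> x \in S by rewrite inE => /andP[].
split=> //.
- move=> i /setU1P[->|iS]; first by rewrite add_vertexR.
  case: add_vertexP => // [x xN ax|_]; last exact: (good_path good_p).
  apply: (@is_path_extend _ _ _ _ x).
  + by rewrite -ax; apply: a_end.
  + by apply: contra vS; apply: (good_mem good_p).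
  + by move: xN; rewrite inE => /andP[].
  + exact: (good_path good_p).
- move=> i x /setU1P[->|iS].
    by rewrite add_vertexR => /R_mem /setU1P[->|/NS xS]; rewrite !inE ?eqxx ?xS ?orbT.
  have pS : x \in p i -> x \in v |: S.
    by move=> /(good_mem good_p iS) xS; rewrite !inE xS orbT.
  case: add_vertexP => // y _ _; rewrite mem_extend inE.
  by case/predU1P=> [->|//]; rewrite setU11.
- move=> x /setU1P[->|xS] //.
  have [c [d [cS dS ncd cx dx]]] := good_ends good_p xS.
  have [xN|xN] := boolP (x \in N); last first.
    exists c, d; split; rewrite ?inE ?cS ?dS ?orbT //;
      by apply: old_end => //; rewrite (negPf xN).
  have [b bx] := R_end xN.
  (* At most one of the two ends at [x] is used up by the extension. Call the surviving one [c]; the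
     other is replaced by an end of [R]. *)
  wlog nc : c d cS dS ncd cx dx / c != a x.
    move=> H; have [ca|] := eqVneq c (a x); last exact: (H c d).
    by apply: (H d c); rewrite // -?ca eq_sym.
  exists (v, b), c; split; rewrite ?inE ?eqxx ?cS ?orbT //.
  + by apply: contraTneq cS => <-.
  + by rewrite /end_of /= add_vertexR.
  + exact: old_end.
- move=> e f eG fG eS' fS' nef.
  have [eS|[x xN ex]] := edge_setU1 eG eS'.
    have [fS|[y yN fy]] := edge_setU1 fG fS'.
      have [i [iS ei fi]] := good_sep good_p eG fG eS fS nef.
      by exists i; rewrite !old_edge // !inE iS orbT.
    (* Among the old indices, only [(a y).1] has the new edge [f] on its path. The double covering
       gives a path through [e] with another index. *)
    have [i [iS ia ei]] := good_cover good_p (a y).1 eG eS.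
    by exists i; rewrite old_edge // fy new_edge // !inE iS orbT.
  have [fS|[y yN fy]] := edge_setU1 fG fS'.
    exists v; rewrite add_vertexR setU11; split=> //.
      by apply/R_edges; exists x.
    by apply/R_edges => -[y _ fy]; rewrite fy new_edge_notsub in fS.
  (* Two new edges are separated by the extended paths, since each of these carries just one new
     edge. *)
  exists (a x).1; rewrite ex fy !new_edge ?aS // !inE aS // eqxx orbT.
  split=> //; apply: contra nef => /eqP/(a_inj xN yN) xy.
  by rewrite ex fy xy.
- move=> e k eG eS'; have [eS|[x xN ex]] := edge_setU1 eG eS'.
    have [i [iS ik ei]] := good_cover good_p k eG eS.
    by exists i; rewrite old_edge // !inE iS orbT.
  (* A new edge lies on [R] and on the extended path of its neighbour; the one not indexed by [k] is
     taken. *)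
  have [<-|nvk] := eqVneq v k.
    by exists (a x).1; rewrite ex new_edge ?aS // neq_v ?aS // eqxx !inE aS // orbT.
  exists v; rewrite setU11 nvk add_vertexR; split=> //.
  by apply/R_edges; exists x.
Qed.

End Step.

(** * Choice of the ends according to the degree of the new vertex *)

Lemma distinct_ends S p x y : good_system S p -> x \in S -> y \in S -> x != y ->
  exists a c, [/\ a.1 \in S, c.1 \in S, a.1 != c.1, end_of p a x & end_of p c y].
Proof.
move=> gp xS yS nxy.
have [c [_ [cS _ _ cy _]]] := good_ends gp yS.
have [a [d [aS dS nad ax dx]]] := good_ends gp xS.
have [ac|] := eqVneq a.1 c.1; last by exists a, c.
have [dc|] := eqVneq d.1 c.1; last by exists d, c.
(* Here both ends at [x] are on the path of [c], so they are its two sides. The end [c] at [y] is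
   one of them, which forces [x] and [y] to be equal. *)
case/eqP: nxy; case: a d c ac dc nad ax dx cy {aS dS cS}
  => [i b] [j b'] [k b''] /= -> ->.
rewrite /end_of /ends_at xpair_eqE eqxx /=.
by case: b b' b'' => [] [] [] // _ /eqP E1 /eqP E2 /eqP E3; move: E3;
  rewrite ?E1 ?E2 => -[].
Qed.

Lemma good_setU1 S v p : v \notin S -> #|nbrs S v| <= 2 -> good_system S p ->
  exists p', good_system (v |: S) p'.
Proof.
move=> vS le2 gp.
have NS x : x \in nbrs S v -> [/\ x \in S, adj x v & x != v].
  by rewrite inE => /andP[xS ->]; split=> //; apply: contraNneq vS => <-.
have [N0|[x xN]] := set_0Vmem (nbrs S v).
  have N0F x : x \in nbrs S v -> false by rewrite N0 inE.
  exists (add_vertex S v [:: v] (fun x => (x, true)) p).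
  apply: add_vertex_good => //.
  - by move=> x /N0F.
  - by move=> x /N0F.
  - by move=> x; rewrite inE => /eqP->; rewrite setU11.
  - by move=> e; apply: (iffP idP) => // -[x /N0F].
  - by move=> x /N0F.
  (* With no neighbour, the two sides of the path reduced to [v] are its two ends. *)
  exists (v, true), (v, false).
  by split; rewrite ?setU11 ?xpair_eqE ?andbF // /end_of add_vertexR /ends_at /=.
have [xS xv nxv] := NS x xN.
have [N1|[y yN']] := set_0Vmem (nbrs S v :\ x).
  have N1E z : z \in nbrs S v -> z = x.
    move=> zN; apply: contraTeq zN => nzx.
    by have := in_set0 z; rewrite -N1 !inE nzx => /= ->.
  have [a [_ [aS _ _ ax _]]] := good_ends gp xS.
  exists (add_vertex S v [:: x; v] (fun=> a) p).
  apply: add_vertex_good => //.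
  - by move=> z /N1E->.
  - by move=> z t /N1E-> /N1E->.
  - by rewrite /is_path /= inE nxv xv.
  - by move=> z; rewrite !inE => /orP[] /eqP->; rewrite ?eqxx ?xS ?xv ?orbT.
  - move=> e; rewrite /path_edges /= inE.
    by apply: (iffP eqP) => [->|[z /N1E-> ->]] //; exists x.
  - by move=> z /N1E->; exists true; rewrite /ends_at /=.
  (* With one neighbour, [v] ends both its own path and the extended one. *)
  exists (v, false), a; split; rewrite ?setU11 ?inE ?aS ?orbT //.
  - by apply: contraTneq aS => <-.
  - by rewrite /end_of add_vertexR /ends_at /=.
  - by apply: (@add_vertex_end S v p [:: x; v] (fun=> a) _ _ _ x) => // z t /N1E-> /N1E->.
have [nyx yN] := setD1P yN'; have [yS yv nyv] := NS y yN.
have N2E z : z \in nbrs S v -> z = x \/ z = y.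
  move=> zN; have NE : nbrs S v = [set x; y].
    apply/esym/eqP; rewrite eqEcard subUset !sub1set xN yN cards2 /=.
    by rewrite eq_sym nyx.
  by move: zN; rewrite NE !inE => /orP[] /eqP; [left | right].
have nxy : x != y by rewrite eq_sym.
have [c [d [cS dS ncd cx dy]]] := distinct_ends gp xS yS nxy.
pose a z := if z == x then c else d.
have ax : a x = c by rewrite /a eqxx.
have ay : a y = d by rewrite /a (negPf nyx).
have aS z : z \in nbrs S v -> (a z).1 \in S by move=> _; rewrite /a; case: ifP.
have a_inj : {in nbrs S v &, injective (fun z => (a z).1)}.
  move=> z t /N2E[] -> /N2E[] -> //; rewrite ax ay => E; move: ncd;
    by rewrite E eqxx.
exists (add_vertex S v [:: x; v; y] a p).
apply: add_vertex_good => //.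
- by move=> z /N2E[] ->; rewrite ?ax ?ay.
- by rewrite /is_path /= !inE negb_or nxv nxy xv eq_sym nyv adj_sym yv.
- by move=> z; rewrite !inE => /or3P[] /eqP->; rewrite ?eqxx ?xS ?yS ?xv ?yv ?orbT.
- move=> e; rewrite /path_edges /= !inE.
  apply: (iffP orP) => [[]/eqP->|[z /N2E[] -> ->]].
  + by exists x.
  + by exists y; rewrite // setUC.
  + by left.
  + by right; rewrite setUC.
- by move=> z /N2E[] ->; [exists true | exists false]; rewrite /ends_at /=.
(* With two neighbours, [v] is interior to its own path, and its two ends are on the two extended
   paths. *)
exists (a x), (a y); rewrite !inE !aS // !orbT; split=> //.
- by rewrite ax ay; apply: contraNneq ncd => ->.
- exact: add_vertex_end.
- exact: add_vertex_end.
Qed.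

(** * Induction on the vertex set, and the bound *)

Lemma degenerate_good_system S : degenerate 2 G -> exists p, good_system S p.
Proof.
move=> degG; have [n] := ubnP #|S|; elim: n S => // n IHn S; rewrite ltnS => leSn.
have [->|S0] := eqVneq S set0.
  exists (fun=> [::]); split=> [i|i x|x|e f eG _|e k eG]; rewrite ?inE //;
  by rewrite subset0 => /eqP e0; case/imset2P: eG => x y _ _ exy;
    have := set21 x y; rewrite -exy e0 inE.
(* Degeneracy is applied to the subgraph induced on [S]; the vertex of small degree that it gives is
   removed and then added back last. *)
pose f x y := [&& x \in S, y \in S & adj x y].
have sub_f : subgraph S f.
  split=> [x y|x y /and3P[]] //.
  by rewrite /f adj_sym andbCA.
have [v vS le2] := degG S f sub_f S0.
have vS' : v \notin S :\ v by rewrite !inE eqxx.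
have [|p gp] := IHn (S :\ v).
  by move: leSn; rewrite (cardsD1 v S) vS.
have := good_setU1 vS' _ gp; rewrite setD1K //; apply.
apply: leq_trans le2; apply: subset_leq_card; apply/subsetP => x.
by rewrite !inE /f vS adj_sym => /andP[/andP[_ ->] ->].
Qed.

End AddVertex.

Lemma good_system_ssp (G : sgraph) (p : G -> seq G) :
  good_system [set: G] p -> ssp G <= #|G|.
Proof.
(* The default value is never taken: a path has distinct vertices, hence at most [#|G|] of them. *)
move=> gp; pose q i : #|G|.-bseq G := insubd [bseq] (p i).
have qE i : q i = p i :> seq G.
  apply: insubdK; rewrite unfold_in.
  have /and3P[_ /card_uniqP <- _] := good_path gp (in_setT i).
  exact: max_card.
pose P := [set q i | i in [set: G]].
have sepP e f : e \in edges G -> f \in edges G -> e != f ->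
    [exists r in P, (e \in path_edges r) && (f \notin path_edges r)].
  move=> eG fG nef.
  have [i [_ ei fi]] := good_sep gp eG fG (subsetT e) (subsetT f) nef.
  by apply/exists_inP; exists (q i); rewrite ?imset_f // qE ei.
have sspP : has_ssp G #|P|.
  apply/existsP; exists P; rewrite eqxx andbT; apply/andP; split.
    apply/forall_inP => _ /imsetP[i _ ->].
    by rewrite qE (good_path gp) ?inE.
  apply/forall_inP => e eG; apply/forall_inP => f fG; apply/implyP => nef.
  by rewrite /separated !sepP // eq_sym.
(* Different indices may carry the same path, so the image has at most [#|G|] elements. *)
apply: (@leq_trans #|P|); last exact/(leq_trans (leq_imset_card _ _))/max_card.
by rewrite /ssp; case: ex_minnP => m _; apply.
Qed.

Theorem theorem1p1 (G : sgraph) (n : nat) (hn : #|G| = n)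
  (hG : degenerate 2 G) : ssp G <= n.
Proof.
by rewrite -hn; have [p] := degenerate_good_system [set: G] hG; apply: good_system_ssp.
Qed.
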